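(* Let $G$ be an ordered group with identity $e$ and let $K\le G$ be a subgroup, with the induced order. For $H\in\mathcal V(G)$, put $K_H:=K\cap H$ and $K_H^-:=K\cap H^-$. Then $\{K_H:H\in\mathcal V(G)\}$ is a chain of convex subgroups of $K$, each of which is a module of the induced order on $K$, and $K_H^-\triangleleft K_H$ for every $H\in\mathcal V(G)$. Moreover, the natural map $$K_H/K_H^-\to H/H^-,\qquad kK_H^-\mapsto kH^-,$$ is an embedding of ordered groups. The factor $K_H/K_H^-$ is nontrivial exactly when $H=S_G(e,k)$ for some $k\in K\setminus\{e\}$, and the order induced on $K$ is recovered from these nontrivial factors by the same leading-layer rule as the order on $G$: for distinct $x,y\in K$, with $H:=S_G(e,x^{-1}y)$, one has $x<y$ if and only if $x^{-1}yK_H^->K_H^-$ in $K_H/K_H^-$. In particular, if $G$ is $N$-free, every nontrivial inherited factor $K_H/K_H^-$ has the same $\mathbf C/\mathbf A$-type as the corresponding ambient factor $H/H^-$.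
   Context: An ordered group is a group $G$ (identity $e$) equipped with a partial order $\le$ such that $x\le y$ implies $axb\le ayb$ for all $a,b,x,y\in G$. It is $N$-free if it has no four distinct elements $a,b,c,d$ whose only strict comparabilities among themselves are $a<b$, $c<b$, $c<d$. A module of a poset $X$ is a subset $M$ such that for every $x\in X\setminus M$ and $m,m'\in M$: $x\le m\iff x\le m'$ and $m\le x\iff m'\le x$. A nonempty module $M$ is strong if every module is disjoint from $M$, contained in $M$, or contains $M$. $S_G(x,y)$ is the least strong module of the poset $G$ containing $x$ and $y$; $\mathcal V(G):=\{S_G(e,g):g\ne e\}$, and $H^-:=\{e\}\cup\bigcup\{L\in\mathcal V(G):L\subsetneq H\}$ for $H\in\mathcal V(G)$. It is known that $\mathcal V(G)$ is a chain under inclusion of convex subgroups and that $H^-$ is a proper convex normal subgroup of $H$. Quotients $P/N$ of an ordered group $P$ by a convex normal subgroup $N$ carry the order $\alpha\le\beta$ iff $a\le b$ for some $a\in\alpha$, $b\in\beta$. An embedding of ordered groups is an injective homomorphism preserving and reflecting the order. A nontrivial ordered group has type $\mathbf C$ if it is totally ordered and type $\mathbf A$ if its order is equality; if $G$ is $N$-free every factor $H/H^-$ has one of these types. *)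

(* Defs.v *)
From HB Require Import structures.
From mathcomp Require Import all_boot all_order.
From mathcomp Require Import boolp classical_sets.

Set Implicit Arguments.
Unset Strict Implicit.
Unset Printing Implicit Defensive.

Import Order.TTheory.

Local Open Scope order_scope.
Local Open Scope group_scope.
Local Open Scope classical_set_scope.

HB.mixin Record isOrderedGroup (d : Order.disp_t) G
    of Group G & Order.POrder d G := {
  le_mulg2 : forall a b x y : G, x <= y -> a * x * b <= a * y * b
}.

#[short(type="orderedGroupType")]
HB.structure Definition OrderedGroup (d : Order.disp_t) :=
  {G of isOrderedGroup d G & Group G & Order.POrder d G}.

Section Posets.
Context {d : Order.disp_t} {T : porderType d}.
Implicit Types (X M A : set T) (x y : T).

Definition Nfree (S : porderType d) : Prop :=
  ~ exists a b c d : S,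
      uniq [:: a; b; c; d] /\
      [/\ a < b, c < b & c < d] /\ [/\ a >< c, a >< d & b >< d].

(* In [is_module] and [convex_in], [X] stands for the poset obtained by
   inducing the order of [T] on the subset [X]. *)
Definition is_module X M : Prop :=
  M `<=` X /\
  forall x m m', X x -> ~ M x -> M m -> M m' ->
    (x <= m <-> x <= m') /\ (m <= x <-> m' <= x).

Definition strong_module M : Prop :=
  [/\ is_module setT M, M !=set0 &
      forall A, is_module setT A ->
        [\/ A `&` M = set0, A `<=` M | M `<=` A]].

Definition smod x y : set T :=
  \bigcap_(M in [set M | [/\ strong_module M, M x & M y]]) M.

(* [smod x y] is the least strong module containing [x] and [y]. *)
Lemma smod_least x y :
  [/\ strong_module (smod x y), smod x y x, smod x y y &
      forall M, strong_module M -> M x -> M y -> smod x y `<=` M].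
Proof.
have sx : smod x y x by move=> M [].
have sy : smod x y y by move=> M [].
split=> //; last by move=> M sM Mx My z; apply.
split; last 1 first.
- move=> A mA; have [dis|/existsNP[M /not_implyP[[sM Mx My] AM]]] :=
    pselect (forall M, [/\ strong_module M, M x & M y] -> A `<=` M).
    by apply: Or32 => z Az M hM; apply: (dis M hM).
  have [_ _ /(_ A mA)[AM0|//|MA]] := sM.
    apply: Or31; rewrite -subset0 => z [Az sz]; rewrite -AM0.
    by split=> //; apply: sz.
  by apply: Or33 => z sz; apply: MA; apply: sz.
- split=> // z m m' _ /existsNP[M /not_implyP[hM nMz]] sm sm'.
  have [[[_ mM] _ _] _ _] := hM.
  by apply: mM => //; [apply: sm | apply: sm'].
- by exists x.
Qed.

Definition convex_in X M : Prop :=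
  forall a b x, M a -> M b -> X x -> a <= x -> x <= b -> M x.

End Posets.

Section Groups.
Context {d : Order.disp_t} {G : orderedGroupType d}.
Implicit Types (P N K H L : set G) (x y : G).

Definition subgroup P : Prop := group_closed [in P].

Definition convex_subgroup P N : Prop :=
  [/\ subgroup N, N `<=` P & convex_in P N].

Definition normal_subgroup P N : Prop :=
  [/\ subgroup N, N `<=` P & forall p n, P p -> N n -> N (n ^ p)].

(* The set V(G) of the modules S_G(1, g) with g != 1. *)
Definition VG : set (set G) := [set smod 1 g | g in [set g | g != 1]].

(* The subset H^- of H. *)
Definition lower H : set G :=
  1 |` \bigcup_(L in [set L | VG L /\ L `<` H]) L.

(* The conditions under which P / N is an ordered group; convexity of N in P
   is what makes the order on cosets antisymmetric. *)
Record quotientable P N : Prop := Quotientable {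
  quot_subgroup : subgroup P;
  quot_normal : normal_subgroup P N;
  quot_convex : convex_in P N
}.

Definition cosetl x N : set G := [set x * n | n in N].

Definition quot P N of quotientable P N :=
  {A : set G | exists2 x, P x & A = cosetl x N}.

End Groups.

Section Quotient.
Context {d : Order.disp_t} {G : orderedGroupType d} {P N : set G}.
Variable h : quotientable P N.
Local Notation Q := (quot h).
Implicit Types (x y : G) (A B C : Q).

Definition coset x (Px : P x) : Q :=
  exist _ (cosetl x N) (ex_intro2 _ _ x Px erefl).

Let P1 : P 1.
Proof. by have [/set_mem] := quot_subgroup h. Qed.
Let PV x : P x -> P x^-1.
Proof.
move=> Px; apply/set_mem/(group_closedV (quot_subgroup h)).
exact/mem_set.
Qed.
Let PM x y : P x -> P y -> P (x * y).
Proof.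
move=> Px Py; apply/set_mem/(group_closedM (quot_subgroup h)); exact/mem_set.
Qed.
Let N1 : N 1.
Proof. by have [[/set_mem]] := quot_normal h. Qed.
Let NV x : N x -> N x^-1.
Proof.
have [sN _ _] := quot_normal h.
move=> Nx; apply/set_mem/(group_closedV sN); exact/mem_set.
Qed.
Let NM x y : N x -> N y -> N (x * y).
Proof.
have [sN _ _] := quot_normal h.
move=> Nx Ny; apply/set_mem/(group_closedM sN); exact/mem_set.
Qed.
Let NJ p n : P p -> N n -> N (n ^ p).
Proof. by have [_ _] := quot_normal h; apply. Qed.

Let cosetlP x y : cosetl x N y <-> N (x^-1 * y).
Proof.
split=> [[n Nn <-]|Nxy]; first by rewrite mulKg.
by exists (x^-1 * y) => //; rewrite mulVKg.
Qed.

Let cosetl_eq x y : N (x^-1 * y) -> cosetl x N = cosetl y N.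
Proof.
move=> Nxy; apply/seteqP; split=> z /cosetlP Nz; apply/cosetlP.
  have -> : y^-1 * z = (x^-1 * y)^-1 * (x^-1 * z).
    by rewrite invgM invgK -mulgA mulVKg.
  by apply: NM => //; apply: NV.
have -> : x^-1 * z = (x^-1 * y) * (y^-1 * z) by rewrite -mulgA mulVKg.
exact: NM.
Qed.

Let quotP A : exists x (Px : P x), A = coset Px.
Proof.
by case: A => A [x Px eA]; subst A; exists x, Px.
Qed.

Let coset_eq x y (Px : P x) (Py : P y) :
  N (x^-1 * y) -> coset Px = coset Py.
Proof. by move=> Nxy; apply/eq_exist/cosetl_eq. Qed.

Let coset_congr x y (Px : P x) (Py : P y) : x = y -> coset Px = coset Py.
Proof. by move=> xy; apply: coset_eq; rewrite xy mulVg. Qed.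

Let mulset (A B : set G) : set G := [set a * b | a in A & b in B].
Let invset (A : set G) : set G := [set a^-1 | a in A].

Let mulset_coset x y : P y ->
  mulset (cosetl x N) (cosetl y N) = cosetl (x * y) N.
Proof.
move=> Py; apply/seteqP; split=> z.
  move=> [_ [n Nn <-]] [_ [m Nm <-]] <-; exists (n ^ y * m).
    by apply: NM => //; apply: NJ.
  by rewrite conjgE !mulgA mulgK.
move=> [n Nn <-]; exists x; first by exists 1; rewrite ?mulg1.
by exists (y * n); [exists n | rewrite mulgA].
Qed.

Let invset_coset x : P x -> invset (cosetl x N) = cosetl x^-1 N.
Proof.
move=> Px; apply/seteqP; split=> z.
  move=> [_ [n Nn <-] <-]; apply/cosetlP.
  have -> : x^-1^-1 * (x * n)^-1 = (n^-1) ^ x^-1.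
    by rewrite conjgE invgK invgM.
  by apply: NJ; [apply: PV | apply: NV].
move=> [n Nn <-]; exists (n^-1 * x); last by rewrite invgM invgK.
exists (n^-1 ^ x); first by apply: NJ => //; apply: NV.
by rewrite conjgE mulVKg.
Qed.

Let mul_subproof A B : exists2 x, P x & mulset (sval A) (sval B) = cosetl x N.
Proof.
have [x [Px ->]] := quotP A; have [y [Py ->]] := quotP B.
by exists (x * y); [apply: PM | apply: mulset_coset].
Qed.

Let inv_subproof A : exists2 x, P x & invset (sval A) = cosetl x N.
Proof.
have [x [Px ->]] := quotP A.
by exists x^-1; [apply: PV | apply: invset_coset].
Qed.

Definition quot_mul A B : Q := exist _ _ (mul_subproof A B).
Definition quot_inv A : Q := exist _ _ (inv_subproof A).
Definition quot_one : Q := coset P1.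
Definition quot_le A B : bool :=
  `[< exists a b : G, [/\ sval A a, sval B b & a <= b] >].

Let quot_mulE x y (Px : P x) (Py : P y) (Pxy : P (x * y)) :
  quot_mul (coset Px) (coset Py) = coset Pxy.
Proof. by apply/eq_exist/mulset_coset. Qed.

Let quot_invE x (Px : P x) (PVx : P x^-1) :
  quot_inv (coset Px) = coset PVx.
Proof. by apply/eq_exist/invset_coset. Qed.

Let quot_leP x y (Px : P x) (Py : P y) :
  quot_le (coset Px) (coset Py) <->
  exists n m, [/\ N n, N m & x * n <= y * m].
Proof.
split=> [/asboolP[_ [_ [[n Nn <-] [m Nm <-] le_nm]]]|[n [m [Nn Nm le_nm]]]].
  by exists n, m.
by apply/asboolP; exists (x * n), (y * m); split=> //; [exists n | exists m].
Qed.

HB.instance Definition _ := gen_eqMixin Q.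
HB.instance Definition _ := gen_choiceMixin Q.

Let quot_mulA : associative quot_mul.
Proof.
move=> A B C; have [x [Px ->]] := quotP A.
have [y [Py ->]] := quotP B; have [z [Pz ->]] := quotP C.
have Pyz := PM Py Pz; have Pxy := PM Px Py.
rewrite (quot_mulE _ _ Pyz) (quot_mulE _ _ Pxy).
rewrite (quot_mulE _ _ (PM Px Pyz)) (quot_mulE _ _ (PM Pxy Pz)).
by apply: coset_congr; rewrite mulgA.
Qed.

Let quot_mul1 : left_id quot_one quot_mul.
Proof.
move=> A; have [x [Px ->]] := quotP A.
by rewrite (quot_mulE _ _ (PM P1 Px)); apply: coset_congr; rewrite mul1g.
Qed.

Let quot_1mul : right_id quot_one quot_mul.
Proof.
move=> A; have [x [Px ->]] := quotP A.
by rewrite (quot_mulE _ _ (PM Px P1)); apply: coset_congr; rewrite mulg1.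
Qed.

Let quot_mulV : left_inverse quot_one quot_inv quot_mul.
Proof.
move=> A; have [x [Px ->]] := quotP A.
rewrite (quot_invE _ (PV Px)) (quot_mulE _ _ (PM (PV Px) Px)).
by apply: coset_congr; rewrite mulVg.
Qed.

Let quot_Vmul : right_inverse quot_one quot_inv quot_mul.
Proof.
move=> A; have [x [Px ->]] := quotP A.
rewrite (quot_invE _ (PV Px)) (quot_mulE _ _ (PM Px (PV Px))).
by apply: coset_congr; rewrite mulgV.
Qed.

HB.instance Definition _ := isGroup.Build Q
  quot_mulA quot_mul1 quot_1mul quot_mulV quot_Vmul.

Let quot_le_refl : reflexive quot_le.
Proof.
by move=> A; have [x [Px ->]] := quotP A; apply/quot_leP; exists 1, 1.
Qed.

Let quot_le_anti : antisymmetric quot_le.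
Proof.
move=> A B; have [x [Px ->]] := quotP A; have [y [Py ->]] := quotP B.
move=> /andP[/quot_leP[n [m [Nn Nm le1]]] /quot_leP[m' [n' [Nm' Nn' le2]]]].
apply: coset_eq; apply: (quot_convex h (a := n * m^-1) (b := n' * m'^-1)).
- by apply: NM => //; apply: NV.
- by apply: NM => //; apply: NV.
- by apply: PM => //; apply: PV.
- by have := le_mulg2 x^-1 m^-1 _ _ le1; rewrite mulKg -!mulgA mulgV mulg1.
- by have := le_mulg2 x^-1 m'^-1 _ _ le2; rewrite mulKg -!mulgA mulgV mulg1.
Qed.

Let quot_le_trans : transitive quot_le.
Proof.
move=> B A C; have [x [Px ->]] := quotP A.
have [y [Py ->]] := quotP B; have [z [Pz ->]] := quotP C.
move=> /quot_leP[n [m [Nn Nm le1]]] /quot_leP[m' [k [Nm' Nk le2]]].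
apply/quot_leP; exists (n * (m^-1 * m')), k; split=> //.
  by do 2?apply: NM => //; apply: NV.
apply: le_trans le2.
have := le_mulg2 1 (m^-1 * m') _ _ le1.
by rewrite !mul1g -!mulgA mulVKg.
Qed.

HB.instance Definition _ := Order.Le_isPOrder.Build d Q
  quot_le_refl quot_le_anti quot_le_trans.

Let quot_le_mul2 (A B X Y : Q) : X <= Y -> A * X * B <= A * Y * B.
Proof.
have [a [Pa ->]] := quotP A; have [b [Pb ->]] := quotP B.
have [x [Px ->]] := quotP X; have [y [Py ->]] := quotP Y.
move=> /quot_leP[n [m [Nn Nm le1]]].
change (quot_le (quot_mul (quot_mul (coset Pa) (coset Px)) (coset Pb))
  (quot_mul (quot_mul (coset Pa) (coset Py)) (coset Pb))).
rewrite !(quot_mulE _ _ (PM Pa Px)) !(quot_mulE _ _ (PM Pa Py)).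
rewrite (quot_mulE _ _ (PM (PM Pa Px) Pb)) (quot_mulE _ _ (PM (PM Pa Py) Pb)).
apply/quot_leP; exists (n ^ b), (m ^ b); split; [exact: NJ | exact: NJ |].
have := le_mulg2 a b _ _ le1.
by rewrite !conjgE !mulgA !mulgK.
Qed.

HB.instance Definition _ := isOrderedGroup.Build d Q quot_le_mul2.

End Quotient.

Section Types.
Context {d : Order.disp_t}.

Definition nontrivial (G : orderedGroupType d) : Prop :=
  exists x : G, x != 1.

Definition typeC (G : orderedGroupType d) : Prop :=
  nontrivial G /\ forall x y : G, x >=< y.

Definition typeA (G : orderedGroupType d) : Prop :=
  nontrivial G /\ forall x y : G, (x <= y) = (x == y).

Definition embedding (G H : orderedGroupType d)
    (f : {multiplicative G -> H}) : Prop :=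
  injective f /\ {mono f : x y / x <= y}.

End Types.

(* Main.v *)
(* Strong modules containing 1 form a chain, and they are permuted by
   translations and inversion; this makes each S(1, g) an inverse-closed set
   stable under its own translations, hence a convex subgroup.  The set H^- is a
   directed union of such subgroups, so it is again a module, and z in H lies
   outside H^- iff S(1, z) = H.  Since H^- is a module, two distinct cosets are
   compared exactly as any of their representatives are; this applies equally
   to the trace of H^- on K, whence the embedding and the leading-layer rule.

   For the type of H / H^-, the comparability graph of an N-free poset is
   P4-free.  If a and b are incomparable, the points adjacent to every common
   neighbour of a and b form a strong module, and likewise with the complement
   graph when a and b are comparable.  If S(1, x) = S(1, y) with x comparable
   and y incomparable to 1, applying this to (1, y) forces x and y to be
   incomparable, and applying it to (1, x) forces them to be comparable.  So the
   elements of H outside H^- are all comparable, or all incomparable, to 1. *)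

Require Import Defs.
From HB Require Import structures.
From mathcomp Require Import all_boot all_order.
From mathcomp Require Import boolp classical_sets.

Import Order.TTheory.

Local Open Scope order_scope.
Local Open Scope group_scope.
Local Open Scope classical_set_scope.

(** * Graphs without induced four-vertex paths, and their hulls *)

(** The vertices may coincide: for symmetric [E], any coincidence among them already yields one of
    the three chords. *)
Definition P4free {T : Type} (E : rel T) : Prop :=
  forall a b c d, E a b -> E b c -> E c d -> [|| E a c, E a d | E b d].

Definition graph_module {T : Type} (E : rel T) (A : set T) : Prop :=
  forall x m m', ~ A x -> A m -> A m' -> E x m = E x m'.

(** For symmetric [E] this is the closure of [a] and [b] in the Galois connection of common
    neighbours. *)
Definition hull {T : Type} (E : rel T) (a b : T) : set T :=
  [set z | forall w, E w a -> E w b -> E w z].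

Lemma hull_witness {T : Type} {E : rel T} {a b z : T} :
  ~ hull E a b z -> exists w, [/\ E w a, E w b & ~~ E w z].
Proof.
move=> /existsNP[w /not_implyP[wa /not_implyP[wb wz]]].
by exists w; split=> //; apply/negP.
Qed.

Lemma hull_nonadj {T : Type} {E : rel T} (Eirr : irreflexive E) {a b z : T} :
  hull E a b z -> ~~ E z a \/ ~~ E z b.
Proof.
move=> Mz; case: (boolP (E z a)) => za; last by left.
case: (boolP (E z b)) => zb; last by right.
by have := Mz z za zb; rewrite Eirr.
Qed.

(** Let [w] witness that [z] is outside. If [z] is adjacent to only one of [a], [b], the path
    through [w] to the other one is induced. If [z] is adjacent to neither but to some [u] in the
    hull, then [z - u - w] extends by [a] or [b], whichever [u] misses, to an induced path. *)
Lemma hull_module {T : Type} {E : rel T} {a b : T} :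
  symmetric E -> irreflexive E -> P4free E -> ~~ E a b ->
  graph_module E (hull E a b).
Proof.
move=> Esym Eirr P4 nab z m m' nMz.
have [w [wa wb nwz]] := hull_witness nMz.
case: (boolP (E z a && E z b)) => [/andP[za zb] Mm Mm'|nzab].
  by rewrite (Mm z za zb) (Mm' z za zb).
have nza : ~~ E z a.
  apply/negP => za; have := P4 z a w b za; rewrite (Esym a w) => /(_ wa wb).
  rewrite (Esym z w) (negPf nwz) (negPf nab) orbF /= => zb.
  by rewrite za zb in nzab.
have nzb : ~~ E z b.
  apply/negP => zb; have := P4 z b w a zb; rewrite (Esym b w) => /(_ wb wa).
  by rewrite (Esym z w) (negPf nwz) (Esym b a) (negPf nab) orbF /= (negPf nza).
suff nzM u : hull E a b u -> E z u = false by move=> /nzM -> /nzM ->.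
move=> Mu; apply/negP => zu; have wu := Mu w wa wb.
have uw : E u w by rewrite Esym.
have [nua|nub] := hull_nonadj Eirr Mu.
  by have := P4 z u w a zu uw wa;
    rewrite (Esym z w) (negPf nwz) (negPf nza) (negPf nua).
by have := P4 z u w b zu uw wb;
  rewrite (Esym z w) (negPf nwz) (negPf nzb) (negPf nub).
Qed.

Lemma hull_strong {T : Type} {E : rel T} {a b : T} :
  symmetric E -> irreflexive E -> P4free E -> ~~ E a b ->
  forall A, graph_module E A ->
    [\/ A `&` hull E a b = set0, A `<=` hull E a b | hull E a b `<=` A].
Proof.
move=> Esym Eirr P4 nab A mA; have mM := hull_module Esym Eirr P4 nab.
have [Ma Mb] : hull E a b a /\ hull E a b b by split=> w.
have [[p [Ap Mp]]|dis] := pselect (exists p, A p /\ hull E a b p); last first.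
  by apply: Or31; rewrite -subset0 => p [Ap Mp]; apply: dis; exists p.
have [AM|/existsNP[q /not_implyP[Aq nMq]]] := pselect (A `<=` hull E a b).
  exact: Or32.
apply: Or33 => r Mr; apply: contrapT => nAr.
(* If [q] is adjacent to [p], it is adjacent to the whole hull, so a hull point outside [A] is
   adjacent to all of [A]. Non-adjacency then spreads membership in [A] from [p] to [a] or [b], then
   to both, then to [r]. *)
case: (boolP (E q p)) => [qp|nqp].
  have Mq u : hull E a b u -> E q u by move=> Mu; rewrite (mM q u p).
  have adj u v : hull E a b u -> ~ A u -> A v -> E u v.
    by move=> Mu nAu Av; rewrite (mA u v q) // Esym Mq.
  have Aa_or_Ab : A a \/ A b.
    apply: contrapT => /not_orP[nAa nAb].
    by have [] := hull_nonadj Eirr Mp; rewrite Esym adj.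
  have [Aa Ab] : A a /\ A b.
    have [Aa|Ab] := Aa_or_Ab; split=> //; apply: contrapT => nA.
      by have := adj b a Mb nA Aa; rewrite Esym (negPf nab).
    by have := adj a b Ma nA Ab; rewrite (negPf nab).
  by have [] := hull_nonadj Eirr Mr; rewrite adj.
(* Otherwise [q] misses the whole hull. The common neighbour [w] separates [q] from [p], so it lies
   in [A]; since [r] is adjacent to [w], it would also be adjacent to [q]. *)
have [w [wa wb nwq]] := hull_witness nMq.
have Aw : A w.
  apply: contrapT => nAw; move: nwq.
  by rewrite (mA w q p nAw Aq Ap) (Mp w wa wb).
have := mA r w q nAr Aw Aq; rewrite Esym (Mr w wa wb) Esym => qr.
by move: nqp; rewrite (mM q p r nMq Mp Mr) -qr.
Qed.

(** * Comparability graphs of N-free posets and mixed strong modules *)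

Definition comparability {d : Order.disp_t} {T : porderType d} : rel T :=
  fun x y => (x != y) && (x >=< y).

Definition incomparability {d : Order.disp_t} {T : porderType d} : rel T :=
  fun x y => x >< y.

Lemma comparability_sym {d : Order.disp_t} {T : porderType d} :
  symmetric (@comparability d T).
Proof. by move=> x y; rewrite /comparability eq_sym comparable_sym. Qed.

Lemma comparability_irr {d : Order.disp_t} {T : porderType d} :
  irreflexive (@comparability d T).
Proof. by move=> x; rewrite /comparability eqxx. Qed.

Lemma incomparability_sym {d : Order.disp_t} {T : porderType d} :
  symmetric (@incomparability d T).
Proof. by move=> x y; rewrite /incomparability comparable_sym. Qed.

Lemma incomparability_irr {d : Order.disp_t} {T : porderType d} :
  irreflexive (@incomparability d T).
Proof. by move=> x; rewrite /incomparability comparablexx. Qed.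

Lemma comparabilityE {d : Order.disp_t} {T : porderType d} (x y : T) :
  comparability x y = (x < y) || (y < x).
Proof.
rewrite /comparability !lt_neqAle (eq_sym y x) -andb_orr.
by rewrite /Order.comparable.
Qed.

Lemma incomparabilityE {d : Order.disp_t} {T : porderType d} (x y : T) :
  incomparability x y = (x != y) && ~~ comparability x y.
Proof.
rewrite /incomparability /comparability.
by case: eqVneq => [->|//]; rewrite comparablexx.
Qed.

(** By transitivity the orientations along a chordless path alternate, so the path is an N read from
    one end or the other. *)
Lemma comparability_P4free {d : Order.disp_t} {T : porderType d} :
  Nfree T -> P4free (@comparability d T).
Proof.
move=> NF a b c d' ab bc cd; apply: contrapT => /negP.
rewrite !negb_or => /and3P[nac nad nbd].
have nca : a != c by apply: contraNneq nad => ->.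
have nda : a != d' by apply: contraNneq nac => ->; rewrite comparability_sym.
have ndb : b != d' by apply: contraNneq nad => <-.
have inc (x y : T) : x != y -> ~~ comparability x y -> x >< y.
  by move=> xy nxy; have := incomparabilityE x y; rewrite xy nxy.
have iac := inc _ _ nca nac; have iad := inc _ _ nda nad.
have ibd := inc _ _ ndb nbd.
have ltC (x y : T) : x < y -> comparability x y by rewrite comparabilityE => ->.
have ltC' (x y : T) : x < y -> comparability y x.
  by rewrite comparabilityE orbC => ->.
apply: NF.
move: (ab) (bc) (cd); rewrite !comparabilityE.
case/orP=> [lab|lba]; case/orP=> [lbc|lcb].
- by move: nac; rewrite (ltC _ _ (lt_trans lab lbc)).
- case/orP=> [lcd|ldc].
    exists a, b, c, d'; split=> //.
    rewrite /= !inE !negb_or nca nda ndb.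
    by rewrite (lt_eqF lab) (lt_eqF lcd) (gt_eqF lcb).
  by move: nbd; rewrite (ltC' _ _ (lt_trans ldc lcb)).
- case/orP=> [lcd|ldc].
    by move: nbd; rewrite (ltC _ _ (lt_trans lbc lcd)).
  exists d', c, b, a; split.
    rewrite /= !inE !negb_or (eq_sym d' b) (eq_sym d' a) (eq_sym c a).
    by rewrite nca nda ndb (lt_eqF ldc) (lt_eqF lba) (gt_eqF lbc).
  by rewrite (comparable_sym b) !(comparable_sym a).
- by move: nac; rewrite (ltC' _ _ (lt_trans lcb lba)).
Qed.

(* The complement of the path [a-b-c-d] is the path [b-d-a-c]. *)
Lemma incomparability_P4free {d : Order.disp_t} {T : porderType d} :
  Nfree T -> P4free (@incomparability d T).
Proof.
move=> /comparability_P4free P4 a b c d'; rewrite !incomparabilityE.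
move=> /andP[nab cab] /andP[nbc cbc] /andP[ncd ccd].
have [eac|nac] := eqVneq a c.
  have [ead|nad] := eqVneq a d'; first by rewrite -ead -eac eqxx in ncd.
  by rewrite eac ccd orbT.
have [ead|nad] := eqVneq a d'.
  by rewrite -ead (eq_sym b) nab (comparability_sym b) cab !orbT.
have [ebd|nbd] := eqVneq b d'.
  by rewrite -ebd cab orbT.
apply: contrapT => /negP; rewrite /= !negb_or !negbK => /and3P[ac ad bd].
have := P4 b d' a c bd; rewrite comparability_sym => /(_ ad ac).
by rewrite comparability_sym (negPf cab) (negPf cbc) comparability_sym (negPf ccd).
Qed.

(** Allows strength of a hull to be tested in a graph: every poset module is among the graph modules
    handled by [hull_strong]. *)
Lemma module_graph_module {d : Order.disp_t} {T : porderType d} (A : set T) :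
  is_module setT A ->
  graph_module comparability A /\ graph_module incomparability A.
Proof.
move=> [_ mA]; suff H x m m' : ~ A x -> A m -> A m' ->
    comparability x m = comparability x m' /\ (x != m) = (x != m').
  split=> x m m' nAx Am Am'; have [] := H x m m' nAx Am Am' => //.
  by rewrite !incomparabilityE => -> ->.
move=> nAx Am Am'; have [le1 le2] := mA x m m' I nAx Am Am'.
have ne u : A u -> x != u by move=> Au; apply/eqP => xu; rewrite xu in nAx.
rewrite /comparability /Order.comparable !ne //=; split=> //.
by congr orb; apply/idP/idP; case: le1 le2 => ? ? [].
Qed.

Lemma is_moduleP {d : Order.disp_t} {T : porderType d} (M : set T) :
  (forall x m m', ~ M x -> M m -> M m' ->
     (x < m -> x < m') /\ (m < x -> m' < x)) ->
  is_module setT M.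
Proof.
move=> mM; split=> // x m m' _ nMx Mm Mm'.
have ne u : M u -> x != u by move=> Mu; apply/eqP => xu; rewrite xu in nMx.
have [h1 h2] := mM x m m' nMx Mm Mm'; have [h3 h4] := mM x m' m nMx Mm' Mm.
have lel u : M u -> (x <= u) = (x < u) by move=> /ne xu; rewrite lt_neqAle xu.
have ler u : M u -> (u <= x) = (u < x).
  by move=> /ne xu; rewrite lt_neqAle eq_sym xu.
by rewrite !lel // !ler.
Qed.

Lemma comparability_hull_strong {d : Order.disp_t} {T : porderType d} (a b : T) :
  Nfree T -> a >< b -> strong_module (hull comparability a b).
Proof.
move=> NF ab.
have nab : ~~ comparability a b by rewrite /comparability negb_and ab orbT.
have P4 := comparability_P4free NF.
have sy := @comparability_sym d T; have ir := @comparability_irr d T.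
have mM := hull_module sy ir P4 nab.
split; last 2 first.
- by exists a => w.
- by move=> A /module_graph_module[mA _]; apply: hull_strong.
(* Two incomparable elements of the hull lie on the same side of [z]; as every
   element of the hull is incomparable to [a] or to [b], and [a] to [b], all
   of them do. *)
apply: is_moduleP => z; set M := hull _ a b => m m' nMz Mm Mm'.
have Ma : M a by move=> w.
have Mb : M b by move=> w.
have tr u v : M u -> M v -> comparability z u -> ~~ comparability u v ->
    (z < u) = (z < v).
  move=> Mu Mv zu nuv; have zv : comparability z v by rewrite -(mM z u v).
  have nvu : ~~ comparability v u by rewrite sy.
  move: zu zv; rewrite !comparabilityE.
  case/orP=> [zu|uz]; case/orP=> [zv|vz].
  - by rewrite zu zv.
  - by move: nvu; rewrite comparabilityE (lt_trans vz zu).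
  - by move: nuv; rewrite comparabilityE (lt_trans uz zv).
  - by rewrite (lt_gtF uz) (lt_gtF vz).
have allm u : M u -> comparability z u -> (z < u) = (z < a).
  move=> Mu zu; have [nua|nub] := hull_nonadj ir Mu; first exact: tr.
  rewrite (tr u b) //; apply: tr => //; first by rewrite -(mM z u b).
  by rewrite sy.
have side : comparability z m -> (z < m) = (z < m').
  by move=> zm; rewrite (allm m) // (allm m') // -(mM z m m').
split=> [zm|mz]; first by rewrite -side // comparabilityE zm.
have zm : comparability z m by rewrite comparabilityE mz orbT.
have := zm; rewrite (mM z m m') // comparabilityE => /orP[|//].
by rewrite -side // lt_gtF.
Qed.

Lemma incomparability_hull_strong {d : Order.disp_t} {T : porderType d} (a b : T) :
  Nfree T -> a >=< b -> strong_module (hull incomparability a b).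
Proof.
move=> NF ab; have nab : ~~ incomparability a b by rewrite /incomparability ab.
have P4 := incomparability_P4free NF.
have sy := @incomparability_sym d T; have ir := @incomparability_irr d T.
have mM := hull_module sy ir P4 nab.
split; last 2 first.
- by exists a => w.
- by move=> A /module_graph_module[_ mA]; apply: hull_strong.
(* A witness [w] that [z] is not in the hull is incomparable to the whole hull
   and comparable to [z], so the hull lies on one side of [z]. *)
apply: is_moduleP => z; set M := hull _ a b => m m' nMz Mm Mm'.
have ne u : M u -> z != u by move=> Mu; apply/eqP => zu; rewrite zu in nMz.
have [w [wa wb nwz]] := hull_witness nMz.
have wm := Mm w wa wb; have wm' := Mm' w wa wb.
have imp u v : M u -> M v -> comparability z u -> comparability z v.
  move=> Mu Mv zu; have := mM z u v nMz Mu Mv.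
  by rewrite !incomparabilityE !ne //= zu; case: comparability.
have nwlt u : incomparability w u -> ~~ ((w < u) || (u < w)).
  by rewrite incomparabilityE comparabilityE => /andP[].
have nw := nwlt _ wm; have nw' := nwlt _ wm'.
have cwz : w != z -> (w < z) || (z < w).
  by move=> wz; move: nwz; rewrite incomparabilityE wz negbK comparabilityE.
(* If [w] is [z], then [z] is incomparable to [m] and [m'], and both implications are vacuous. *)
have [zw|/cwz] := eqVneq w z.
  by move: nw nw'; rewrite zw !negb_or => /andP[/negPf-> /negPf->] /andP[].
move=> {}cwz; split=> lt1.
  have := imp m m' Mm Mm'; rewrite !comparabilityE lt1 => /(_ isT)/orP[//|m'z].
  move: nw nw'; rewrite !negb_or => /andP[nwm _] /andP[_ nm'w].
  case/orP: cwz => [wz|zw].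
    by rewrite (lt_trans wz lt1) in nwm.
  by rewrite (lt_trans m'z zw) in nm'w.
have := imp m m' Mm Mm'; rewrite !comparabilityE lt1 orbT => /(_ isT)/orP[zm'|//].
move: nw nw'; rewrite !negb_or => /andP[_ nmw] /andP[nwm' _].
case/orP: cwz => [wz|zw].
  by rewrite (lt_trans wz zm') in nwm'.
by rewrite (lt_trans lt1 zw) in nmw.
Qed.

Lemma smod_mixed {d : Order.disp_t} {T : porderType d} (a x y : T) :
  Nfree T -> x != a -> a >=< x -> a >< y -> smod a x <> smod a y.
Proof.
move=> NF xa ax ay e.
have [_ _ sx_x _] := smod_least a x; have [_ _ sy_y _] := smod_least a y.
have hyp : hull comparability a y x.
  rewrite e in sx_x; apply: sx_x; split; last 2 first.
  - by move=> w.
  - by move=> w.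
  exact: comparability_hull_strong.
have hxy : hull incomparability a x y.
  rewrite -e in sy_y; apply: sy_y; split; last 2 first.
  - by move=> w.
  - by move=> w.
  exact: incomparability_hull_strong.
(* Were [x] adjacent to [y], it would be a common neighbour of [a] and [y], hence adjacent to
   itself. The dual argument for [y] in the other hull concludes. *)
have nxy : ~~ comparability x y.
  apply/negP => xy; have := hyp x _ xy.
  by rewrite comparability_irr /comparability xa comparable_sym ax => /(_ isT).
have yx : incomparability y x.
  rewrite incomparability_sym incomparabilityE nxy andbT.
  by apply: contraNneq ay => <-.
have := hxy y _ yx; rewrite incomparability_irr incomparability_sym.
by move=> /(_ ay).
Qed.

(** * Transport of modules along bijections, and general module facts *)

Lemma module_preim {d : Order.disp_t} {T : porderType d} (f : T -> T) (A : set T) :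
  {mono f : x y / x <= y} -> is_module setT A -> is_module setT (f @^-1` A).
Proof.
move=> fm [_ mA]; split=> // x m m' _ nAx Am Am'.
by have := mA (f x) (f m) (f m') I nAx Am Am'; rewrite !fm.
Qed.

Lemma module_preim_anti {d : Order.disp_t} {T : porderType d} (f : T -> T)
    (A : set T) :
  {mono f : x y /~ x <= y} -> is_module setT A -> is_module setT (f @^-1` A).
Proof.
move=> fm [_ mA]; split=> // x m m' _ nAx Am Am'.
by have [] := mA (f x) (f m) (f m') I nAx Am Am'; rewrite !fm.
Qed.

(** A test module is carried over by [g], compared with [M], and carried back. Only stability of
    modules under preimages is assumed, so that translations and the order-reversing inversion are
    both covered. *)
Lemma strong_preim {d : Order.disp_t} {T : porderType d} {f g : T -> T}
    (M : set T) :
  cancel f g -> cancel g f ->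
  (forall A, is_module setT A -> is_module setT (f @^-1` A)) ->
  (forall A, is_module setT A -> is_module setT (g @^-1` A)) ->
  strong_module M -> strong_module (f @^-1` M).
Proof.
move=> fK gK mf mg [mM [x Mx] sM]; split; first exact: mf.
  by exists (g x); rewrite /= gK.
move=> A /mg /sM[AM0|AM|MA].
- apply: Or31; rewrite -subset0 => z [Az Mz].
  suff : (g @^-1` A `&` M) (f z) by rewrite AM0.
  by split; rewrite /= ?fK.
- by apply: Or32 => z Az; apply: AM; rewrite /= fK.
- by apply: Or33 => z /MA; rewrite /= fK.
Qed.

Lemma strong_chain {d : Order.disp_t} {T : porderType d} {L M : set T} (x : T) :
  strong_module L -> strong_module M -> L x -> M x -> L `<=` M \/ M `<=` L.
Proof.
move=> [mL _ _] [_ _ sM] Lx Mx; have [LM0|LM|ML] := sM L mL.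
- by have : (L `&` M) x by []; rewrite LM0.
- by left.
- by right.
Qed.

Lemma smod_refl {d : Order.disp_t} {T : porderType d} (x : T) :
  smod x x = [set x].
Proof.
have [_ sx _ least] := smod_least x x.
apply/seteqP; split=> [|_ ->//]; apply: least => //; split.
- by split=> // z m m' _ _ -> ->.
- by exists x.
- move=> A _; have [Ax|nAx] := pselect (A x); first by apply: Or33 => _ ->.
  by apply: Or31; rewrite -subset0 => z [Az zx]; apply: nAx; rewrite -zx.
Qed.

Lemma module_convex {d : Order.disp_t} {T : porderType d} {X M : set T} :
  is_module X M -> convex_in X M.
Proof.
move=> [_ mM] a b x Ma Mb Xx ax xb; apply: contrapT => nMx.
have [_ [/(_ ax) bx _]] := mM x a b Xx nMx Ma Mb.
by apply: nMx; rewrite (@le_anti _ _ x b) // xb.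
Qed.

Lemma module_setI {d : Order.disp_t} {T : porderType d} (X M : set T) :
  is_module setT M -> is_module X (X `&` M).
Proof.
move=> [_ mM]; split=> [z []//|x m m' Xx nMx [_ Mm] [_ Mm']].
by apply: mM => // Mx; apply: nMx.
Qed.

Lemma module_sub {d : Order.disp_t} {T : porderType d} (X Y M : set T) :
  M `<=` X -> X `<=` Y -> is_module Y M -> is_module X M.
Proof.
by move=> MX XY [_ mM]; split=> // x m m' /XY; apply: mM.
Qed.

(** * Subgroups, translations and inversion in an ordered group *)

Lemma subgroupP {d : Order.disp_t} {G : orderedGroupType d} (P : set G) :
  subgroup P <-> P 1 /\ forall x y, P x -> P y -> P (x^-1 * y).
Proof.
split=> [sP|[P1 PD]].
  split=> [|x y Px Py]; first by have [/set_mem] := sP.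
  apply/set_mem/(group_closedM sP); last exact/mem_set.
  exact/(group_closedV sP)/mem_set.
split=> [|x y /set_mem Px /set_mem Py]; first exact/mem_set.
have PV z : P z -> P z^-1 by move=> /PD /(_ P1); rewrite mulg1.
by apply/mem_set; rewrite -[x]invgK; apply: PD; apply: PV.
Qed.

Lemma subgroup_setI {d : Order.disp_t} {G : orderedGroupType d} (P Q : set G) :
  subgroup P -> subgroup Q -> subgroup (P `&` Q).
Proof.
move=> /subgroupP[P1 PD] /subgroupP[Q1 QD]; apply/subgroupP; split=> //.
by move=> x y [Px Qx] [Py Qy]; split; [apply: PD | apply: QD].
Qed.

Lemma subgroup_inv {d : Order.disp_t} {G : orderedGroupType d} {P : set G} {x : G} :
  subgroup P -> P x -> P x^-1.
Proof. by move=> /subgroupP[P1 PD] Px; rewrite -[x^-1]mulg1; apply: PD. Qed.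

Lemma subgroup_mul {d : Order.disp_t} {G : orderedGroupType d} {P : set G}
    {x y : G} :
  subgroup P -> P x -> P y -> P (x * y).
Proof.
move=> sP Px Py; have /subgroupP[_ PD] := sP.
by rewrite -[x]invgK; apply: PD => //; apply: subgroup_inv.
Qed.

Lemma mul2_mono {d : Order.disp_t} {G : orderedGroupType d} (a b : G) :
  {mono (fun x => a * x * b) : x y / x <= y}.
Proof.
move=> x y; apply/idP/idP; last exact: le_mulg2.
move=> /(le_mulg2 a^-1 b^-1).
by rewrite !mulgA !mulVg !mul1g -!mulgA !mulgV !mulg1.
Qed.

Lemma inv_anti {d : Order.disp_t} {G : orderedGroupType d} :
  {mono (fun x : G => x^-1) : x y /~ x <= y}.
Proof.
have H (x y : G) : x <= y -> y^-1 <= x^-1.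
  by move=> /(le_mulg2 x^-1 y^-1); rewrite mulVg mul1g -mulgA mulgV mulg1.
by move=> x y; apply/idP/idP => [/H|/H//]; rewrite !invgK.
Qed.

(** The two-sided form serves left translation and also conjugation. *)
Lemma strong_mul2 {d : Order.disp_t} {G : orderedGroupType d} (a b : G)
    (M : set G) :
  strong_module M -> strong_module [set x | M (a * x * b)].
Proof.
apply: (strong_preim (g := fun x => a^-1 * x * b^-1)).
- by move=> x; rewrite !mulgA mulVg mul1g -mulgA mulgV mulg1.
- by move=> x; rewrite !mulgA mulgV mul1g -mulgA mulVg mulg1.
- by move=> A; apply/module_preim/mul2_mono.
- by move=> A; apply/module_preim/mul2_mono.
Qed.

Lemma strong_mul {d : Order.disp_t} {G : orderedGroupType d} (a : G) (M : set G) :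
  strong_module M -> strong_module [set x | M (a * x)].
Proof.
by move=> /(strong_mul2 a 1); congr strong_module; apply/seteqP; split=> x /=;
  rewrite mulg1.
Qed.

(* Inversion preserves strong modules, and [M] and [M^-1] both contain [1], so
   they are comparable, hence equal. *)
Lemma strong_inv {d : Order.disp_t} {G : orderedGroupType d} {M : set G} {x : G} :
  strong_module M -> M 1 -> M x^-1 -> M x.
Proof.
move=> sM M1; have sMV : strong_module [set x | M x^-1].
  by apply: (strong_preim (g := fun x => x^-1)) sM; try exact: invgK;
    move=> A; apply/module_preim_anti/inv_anti.
have [|MV|VM] := strong_chain 1 sM sMV M1; first by rewrite /= invg1.
  by move=> /MV /=; rewrite invgK.
exact: VM.
Qed.

(* Translates of [M = smod 1 g] by its elements are strong modules; those that
   contain [1] and [g^-1] contain [M]. *)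
Lemma smod_subgroup {d : Order.disp_t} {G : orderedGroupType d} (g : G) :
  subgroup (smod 1 g).
Proof.
have [sM M1 Mg least] := smod_least 1 g; set M := smod 1 g in sM M1 Mg least *.
have MV x : M x^-1 -> M x := strong_inv sM M1.
have MV' x : M x -> M x^-1 by rewrite -{1}[x]invgK; apply: MV.
have translate a : M a -> M (a * g^-1) -> M `<=` [set x | M (a * x)].
  move=> Ma Mag; have sMa := strong_mul a _ sM.
  have M1a : [set x | M (a * x)] 1 by rewrite /= mulg1.
  by apply: least => //; apply: (strong_inv sMa).
have Mgx : M `<=` [set x | M (g * x)] by apply: translate; rewrite ?mulgV.
apply/subgroupP; split=> // x y Mx.
apply: (translate x^-1); first exact: MV'.
by rewrite -invgM; apply: MV'; apply: (Mgx x).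
Qed.

(** * The chain [VG] and the subgroups [lower H] *)

Lemma smod_module {d : Order.disp_t} {T : porderType d} (x y : T) :
  is_module setT (smod x y).
Proof. by have [[]] := smod_least x y. Qed.

Lemma smod_total {d : Order.disp_t} {T : porderType d} (a x y : T) :
  smod a x `<=` smod a y \/ smod a y `<=` smod a x.
Proof.
have [sx xa _ _] := smod_least a x; have [sy ya _ _] := smod_least a y.
exact: strong_chain sx sy xa ya.
Qed.

Lemma VG_subgroup {d : Order.disp_t} {G : orderedGroupType d} (H : set G) :
  VG H -> subgroup H.
Proof. by move=> [g _ <-]; apply: smod_subgroup. Qed.

Lemma VG_module {d : Order.disp_t} {G : orderedGroupType d} (H : set G) :
  VG H -> is_module setT H.
Proof. by move=> [g _ <-]; apply: smod_module. Qed.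

Lemma VG_smod_sub {d : Order.disp_t} {G : orderedGroupType d} {H : set G} {z : G} :
  VG H -> H z -> smod 1 z `<=` H.
Proof.
move=> [g _ <-] Hz; have [sM M1 Mg _] := smod_least 1 g.
by have [_ _ _ least] := smod_least 1 z; apply: least.
Qed.

Lemma subset_proper_trans {T : Type} {A B C : set T} :
  A `<=` B -> B `<` C -> A `<` C.
Proof.
move=> AB [BC nCB]; split; first exact: subset_trans BC.
by move=> CA; apply: nCB; apply: subset_trans AB.
Qed.

Lemma lowerP {d : Order.disp_t} {G : orderedGroupType d} {H : set G} (z : G) :
  VG H -> lower H z <-> smod 1 z `<` H.
Proof.
move=> VH; have [_ _ zz _] := smod_least 1 z; split=> [|zH].
  move=> [->|[L [VL LH] Lz]].
    (* For [z = 1] the strong module is the singleton of [1], proper in [H] because [H] contains its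
       generator [g != 1]. *)
    rewrite smod_refl; case: VH => g /eqP g1 <-.
    have [_ M1 Mg _] := smod_least 1 g; split=> [_ ->//|/(_ _ Mg)]; exact: g1.
  exact: subset_proper_trans (VG_smod_sub VL Lz) LH.
have [->|z1] := eqVneq z 1; first by left.
by right; exists (smod 1 z) => //; split=> //; exists z.
Qed.

Lemma lowerE {d : Order.disp_t} {G : orderedGroupType d} {H : set G} (z : G) :
  VG H -> H z -> lower H z <-> smod 1 z <> H.
Proof.
move=> VH Hz; rewrite lowerP // properEneq; split=> [[/eqP]//|ne].
by split; [apply/eqP | apply: VG_smod_sub].
Qed.

Lemma lower_sub {d : Order.disp_t} {G : orderedGroupType d} {H : set G} :
  VG H -> lower H `<=` H.
Proof.
move=> VH z /(lowerP z VH)[zH _]; apply: zH.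
by have [] := smod_least 1 z.
Qed.

(** The larger of [smod 1 x] and [smod 1 y] works. Properties of [lower H] involving two of its
    elements thus reduce to a single [smod 1 g]. *)
Lemma lower_directed {d : Order.disp_t} {G : orderedGroupType d} {H : set G}
    (x y : G) :
  VG H -> lower H x -> lower H y ->
  exists g, [/\ smod 1 g x, smod 1 g y & smod 1 g `<=` lower H].
Proof.
move=> VH Lx Ly.
have sub g : lower H g -> smod 1 g `<=` lower H.
  move=> /(lowerP g VH) gH z gz; apply/(lowerP z VH).
  apply: subset_proper_trans gH; have [_ _ _] := smod_least 1 z; apply=> //.
    by have [] := smod_least 1 g.
  by have [] := smod_least 1 g.
have [_ _ xx _] := smod_least 1 x; have [_ _ yy _] := smod_least 1 y.
have [xy|yx] := smod_total 1 x y.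
  by exists y; split; [apply: xy | | apply: sub].
by exists x; split; [| apply: yx | apply: sub].
Qed.

Lemma lower_subgroup {d : Order.disp_t} {G : orderedGroupType d} {H : set G} :
  VG H -> subgroup (lower H).
Proof.
move=> VH; apply/subgroupP; split=> [|x y Lx Ly]; first by left.
have [g [gx gy]] := lower_directed _ _ VH Lx Ly; apply.
by have /subgroupP[_] := smod_subgroup g; apply.
Qed.

Lemma lower_module {d : Order.disp_t} {G : orderedGroupType d} {H : set G} :
  VG H -> is_module setT (lower H).
Proof.
move=> VH; split=> // z x y _ nLz Lx Ly.
have [g [gx gy gL]] := lower_directed _ _ VH Lx Ly.
by have [_] := smod_module 1 g; apply=> // /gL.
Qed.

Lemma lower_normal {d : Order.disp_t} {G : orderedGroupType d} {H : set G} :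
  VG H -> normal_subgroup H (lower H).
Proof.
move=> VH; have sH := VG_subgroup _ VH.
have HJ p z : H p -> H z -> H (z ^ p).
  move=> Hp Hz; rewrite conjgE.
  by do 2?[apply: subgroup_mul => //]; apply: subgroup_inv.
split; [exact: lower_subgroup | exact: lower_sub |].
move=> p n Hp Ln; have Hn := lower_sub VH _ Ln.
apply/lowerE; [by [] | exact: HJ |] => e.
move/(lowerE _ VH Hn): Ln; apply; apply/seteqP; split; first exact: VG_smod_sub.
have [sn n1 nn _] := smod_least 1 n.
have [_ _ _ least] := smod_least 1 (n ^ p).
(* The conjugate of [smod 1 n] by [p] is a strong module containing [1] and [n ^ p], so it contains
   [H]. Conjugating back puts [H] inside [smod 1 n], against [n] being in [lower H]. *)
have Hsub : H `<=` [set x | smod 1 n (p * x * p^-1)].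
  rewrite -{1}e; apply: least; first exact: strong_mul2.
    by rewrite /= mulg1 mulgV.
  by rewrite /= conjgE !mulgA mulgV mul1g -mulgA mulgV mulg1.
move=> h /(HJ p h Hp) /Hsub /=.
by rewrite conjgE !mulgA mulgV mul1g -mulgA mulgV mulg1.
Qed.

(** * The order on a quotient by a normal module, and maps between quotients *)

Section QuotientTheory.
Context {d : Order.disp_t} {G : orderedGroupType d} {P N : set G}.
Variable q : quotientable P N.

Lemma quot_ind (Q : quot q -> Prop) :
  (forall x (Px : P x), Q (coset q Px)) -> forall A, Q A.
Proof. by move=> QC [A [x Px eA]]; subst A; apply: QC. Qed.

Lemma coset_eqP x y (Px : P x) (Py : P y) :
  coset q Px = coset q Py <-> N (x^-1 * y).
Proof.
have [sN _ _] := quot_normal q; have /subgroupP[N1 ND] := sN.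
split=> [e|Nxy].
  have : cosetl y N y by exists 1; rewrite ?mulg1.
  by rewrite -[cosetl y N]/(sval (coset q Py)) -e => -[n Nn <-]; rewrite mulKg.
apply: eq_exist; apply/seteqP; split=> _ [n Nn <-].
  exists ((x^-1 * y)^-1 * n); first exact: ND.
  by rewrite invgM invgK !mulgA mulgV mul1g.
exists ((x^-1 * y) * n); first exact: subgroup_mul.
by rewrite !mulgA mulgV mul1g.
Qed.

Lemma coset_mul x y (Px : P x) (Py : P y) (Pxy : P (x * y)) :
  coset q Px * coset q Py = coset q Pxy.
Proof.
have [sN _ NJ] := quot_normal q; have /subgroupP[N1 ND] := sN.
apply: eq_exist; apply/seteqP; split=> z.
  move=> [_ [n Nn <-] [_ [m Nm <-] <-]]; exists (n ^ y * m).
    by apply: subgroup_mul => //; apply: NJ.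
  by rewrite conjgE !mulgA mulgK.
move=> [n Nn <-]; exists x; first by exists 1; rewrite ?mulg1.
by exists (y * n); [exists n | rewrite mulgA].
Qed.

Lemma coset1 (P1 : P 1) : 1 = coset q P1.
Proof. exact: eq_exist. Qed.

(** With [t = x^-1 * y] outside [N], elements outside [N] cannot distinguish members of [N]:
    [n <= t * m] gives [1 <= t * m], that is [m^-1 <= t], and then [1 <= t]. *)
Lemma coset_leP x y (Px : P x) (Py : P y) : is_module P N ->
  coset q Px <= coset q Py <-> N (x^-1 * y) \/ x <= y.
Proof.
move=> [_ mN]; have [sN NP _] := quot_normal q; have sP := quot_subgroup q.
have /subgroupP[N1 _] := sN; split; last first.
  move=> [/(coset_eqP x y Px Py) -> //|xy].
  by apply/asboolP; exists x, y; split=> //; exists 1; rewrite ?mulg1.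
move=> /asboolP[_ [_ [[n Nn <-] [m Nm <-] xnym]]].
have [|nNt] := pselect (N (x^-1 * y)); [by left | right].
have Pt : P (x^-1 * y) by apply: subgroup_mul => //; apply: subgroup_inv.
have Ptm : P (x^-1 * y * m) by apply: subgroup_mul => //; apply: NP.
have nNtm : ~ N (x^-1 * y * m).
  move=> Ntm; apply: nNt; rewrite -[_ * y](mulgK m).
  by apply: subgroup_mul => //; apply: subgroup_inv.
have n_le : n <= x^-1 * y * m.
  by move: xnym => /(le_mulg2 x^-1 1); rewrite !mulg1 mulKg !mulgA.
have [_ [/(_ n_le) tm_ge1 _]] := mN _ n 1 Ptm nNtm Nn N1.
have mV_le : m^-1 <= x^-1 * y.
  by move: tm_ge1 => /(le_mulg2 1 m^-1); rewrite !mul1g mulgK.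
have [_ [/(_ mV_le) t_ge1 _]] :=
  mN _ m^-1 1 Pt nNt (subgroup_inv sN Nm) N1.
by move: t_ge1 => /(le_mulg2 x 1); rewrite !mulg1 mulVKg.
Qed.

Lemma coset_gt1P x (Px : P x) : is_module P N -> ~ N x ->
  1 < coset q Px <-> 1 < x.
Proof.
move=> mN nNx; have /subgroupP[P1 _] := quot_subgroup q.
have [/subgroupP[N1 _] _ _] := quot_normal q.
rewrite (coset1 P1) !lt_neqAle; split=> /andP[_ le1].
  have /(coset_leP _ _ _ _ mN)[|->] := le1; first by rewrite invg1 mul1g.
  by rewrite andbT; apply/eqP => x1; rewrite -x1 in nNx.
apply/andP; split; last by apply/coset_leP => //; right.
by apply/eqP => /coset_eqP; rewrite invg1 mul1g.
Qed.

Lemma quot_nontrivialP : nontrivial (quot q) <-> exists x, P x /\ ~ N x.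
Proof.
have /subgroupP[P1 _] := quot_subgroup q.
split=> [[A]|[x [Px nNx]]].
  elim/quot_ind: A => x Px /eqP ne; exists x; split=> // Nx; apply: ne.
  rewrite (coset1 P1); apply/esym/coset_eqP.
  by rewrite invg1 mul1g.
exists (coset q Px); apply/eqP => /esym; rewrite (coset1 P1) => /coset_eqP.
by rewrite invg1 mul1g.
Qed.

End QuotientTheory.

(** A representative is chosen in each coset; [N'] lying in [N] makes the image independent of the
    choice. *)
Lemma quot_natural_map {d : Order.disp_t} {G : orderedGroupType d}
    {P' N' P N : set G} (q' : quotientable P' N') (q : quotientable P N) :
  P' `<=` P -> N' `<=` N ->
  exists f : {multiplicative quot q' -> quot q},
    forall k (k' : P' k) (kP : P k), f (coset q' k') = coset q kP.
Proof.
move=> PP NN.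
have rep (A : quot q') : {x & {Px : P' x | A = coset q' Px}}.
  apply: cid; have : exists x, exists Px : P' x, A = coset q' Px.
    by elim/(quot_ind q'): A => x Px; exists x, Px.
  by move=> [x hx]; exists x; apply: cid.
pose f (A : quot q') : quot q := coset q (PP _ (sval (projT2 (rep A)))).
have fE k (k' : P' k) (kP : P k) : f (coset q' k') = coset q kP.
  rewrite /f; case: (rep _) => x [Px /= /esym/coset_eqP e].
  by apply/coset_eqP/NN.
have fM : {morph f : A B / A * B}.
  move=> A B; elim/(quot_ind q'): A => x Px; elim/(quot_ind q'): B => y Py.
  have Pxy := subgroup_mul (quot_subgroup q') Px Py.
  rewrite (coset_mul q' _ _ _ _ Pxy) !(fE _ _ (PP _ _)) //.
  by rewrite (coset_mul q _ _ _ _ (PP _ Pxy)).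
pose mf := isMultiplicative.Build _ _ f fM.
pose F : {multiplicative quot q' -> quot q} := HB.pack f mf.
by exists F.
Qed.

Lemma embedding_typeC {d : Order.disp_t} {A B : orderedGroupType d}
    (f : {multiplicative A -> B}) :
  embedding f -> nontrivial A -> typeC B -> typeC A.
Proof.
move=> [_ fm] ntA [_ tot]; split=> // x y.
by have := tot (f x) (f y); rewrite /Order.comparable !fm.
Qed.

Lemma embedding_typeA {d : Order.disp_t} {A B : orderedGroupType d}
    (f : {multiplicative A -> B}) :
  embedding f -> nontrivial A -> typeA B -> typeA A.
Proof.
move=> [fi fm] ntA [_ triv]; split=> // x y.
by rewrite -fm triv (inj_eq fi).
Qed.

(** * The factors [H / H^-] and their types *)

Lemma VG_quotientable {d : Order.disp_t} {G : orderedGroupType d} {H : set G} :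
  VG H -> quotientable H (lower H).
Proof.
move=> VH; split; [exact: VG_subgroup | exact: lower_normal |].
by apply/module_convex/(module_sub _ _ _ (lower_sub VH) _ (lower_module VH)).
Qed.

(** The generator [g] of [H] decides the type: each element of [H] outside [lower H] has the same
    strong module as [g], so [smod_mixed] makes it comparable to [1] exactly when [g] is. Left
    translation passes from [1] to arbitrary pairs. *)
Lemma VG_factor_type {d : Order.disp_t} {G : orderedGroupType d} {H : set G}
    (VH : VG H) (q : quotientable H (lower H)) :
  Nfree G -> typeC (quot q) \/ typeA (quot q).
Proof.
move=> NF; have mL : is_module H (lower H).
  exact: module_sub (lower_sub VH) _ (lower_module VH).
have sH := VG_subgroup _ VH; have [g /= g1 gH] := VH.
have Hg : H g by rewrite -gH; have [] := smod_least 1 g.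
have nt : nontrivial (quot q).
  by apply/quot_nontrivialP; exists g; split=> //; move/(lowerE g VH Hg).
have HD x y : H x -> H y -> H (x^-1 * y) by have /subgroupP[_] := sH; apply.
have full z : H z -> ~ lower H z -> smod 1 z = smod 1 g.
  by move=> Hz nLz; rewrite gH; apply: contrapT => /(lowerE z VH Hz).
have le_div (x y : G) : (1 <= x^-1 * y) = (x <= y).
  by rewrite -(mul2_mono x^-1 1 x y) !mulg1 mulVg.
have ge_div (x y : G) : (x^-1 * y <= 1) = (y <= x).
  by rewrite -(mul2_mono x^-1 1 y x) !mulg1 mulVg.
have [cg|ig] := boolP (1 >=< g); [left | right]; split=> // A B.
  elim/(quot_ind q): A => x Hx; elim/(quot_ind q): B => y Hy.
  have [Lxy|nLxy] := pselect (lower H (x^-1 * y)).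
    by rewrite ((coset_eqP q x y Hx Hy).2 Lxy) comparablexx.
  have : 1 >=< x^-1 * y.
    apply: contrapT => /negP ixy; apply: (smod_mixed 1 g _ NF g1 cg ixy).
    by rewrite full //; apply: HD.
  rewrite /Order.comparable le_div ge_div => /orP[xy|yx]; apply/orP.
    by left; apply/coset_leP => //; right.
  by right; apply/coset_leP => //; right.
elim/(quot_ind q): A => x Hx; elim/(quot_ind q): B => y Hy.
apply/idP/eqP => [/(coset_leP q x y Hx Hy mL) xy|-> //].
apply/coset_eqP; case: xy => // xy; apply: contrapT => nLxy.
have z1 : x^-1 * y != 1 by apply/eqP => e; apply: nLxy; rewrite e; left.
apply: (smod_mixed 1 (x^-1 * y) g NF z1 _ ig); last by rewrite full //; apply: HD.
by rewrite /Order.comparable le_div xy.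
Qed.

(** * Traces on a subgroup and the inherited factors *)

Lemma trace_normal {d : Order.disp_t} {G : orderedGroupType d} {K P N : set G} :
  subgroup K -> normal_subgroup P N -> normal_subgroup (K `&` P) (K `&` N).
Proof.
move=> sK [sN NP NJ]; split; first exact: subgroup_setI.
  by move=> z [Kz /NP].
move=> p n [Kp Pp] [Kn Nn]; split; last exact: NJ.
by rewrite conjgE; do 2?[apply: subgroup_mul => //]; apply: subgroup_inv.
Qed.

(** Makes [coset_leP] available for the inherited factors. *)
Lemma trace_module {d : Order.disp_t} {T : porderType d} {K P N : set T} :
  is_module setT N -> N `<=` P -> is_module (K `&` P) (K `&` N).
Proof.
move=> mN NP; apply: (module_sub _ K); last exact: module_setI.
  by move=> z [Kz /NP].
by move=> z [].
Qed.

Theorem corollary5p3 (d : Order.disp_t) (G : orderedGroupType d)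
    (K : set G) (hK : subgroup K) :
  total_on [set K `&` H | H in VG] subset /\
  (forall H : set G, VG H ->
     convex_subgroup K (K `&` H) /\ is_module K (K `&` H)) /\
  (forall H : set G, VG H ->
     normal_subgroup (K `&` H) (K `&` lower H) /\
     exists (qK : quotientable (K `&` H) (K `&` lower H))
            (qH : quotientable H (lower H)),
       (exists f : {multiplicative quot qK -> quot qH},
          (forall (k : G) (kK : (K `&` H) k) (kH : H k),
             f (coset qK kK) = coset qH kH) /\
          embedding f) /\
       (nontrivial (quot qK) <->
          exists k : G, [/\ K k, k != 1 & H = smod 1 k]) /\
       (forall x y : G, K x -> K y -> x != y -> H = smod 1 (x^-1 * y) ->
          exists h : (K `&` H) (x^-1 * y), x < y <-> 1 < coset qK h) /\
       (Nfree G -> nontrivial (quot qK) ->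
          (typeC (quot qK) /\ typeC (quot qH)) \/
          (typeA (quot qK) /\ typeA (quot qH)))).
Proof.
split.
  move=> _ _ [_ [x _ <-] <-] [_ [y _ <-] <-].
  by have [xy|yx] := smod_total 1 x y; [left | right]; apply: setIS.
split=> H VH.
  have mKH := module_setI K H (VG_module _ VH); split=> //; split.
  - by apply: subgroup_setI => //; apply: VG_subgroup.
  - by move=> z [].
  - exact: module_convex.
have sH := VG_subgroup _ VH; have qH := VG_quotientable VH.
have nK := trace_normal hK (quot_normal qH).
have mL := lower_module VH; have LH := lower_sub VH.
have mK : is_module (K `&` H) (K `&` lower H) by apply: trace_module.
have mH : is_module H (lower H) by apply: module_sub mL.
have qK : quotientable (K `&` H) (K `&` lower H).
  by split=> //; [apply: subgroup_setI | apply: module_convex].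
split=> //; exists qK, qH.
have [f fE] := quot_natural_map qK qH (@subIsetr _ K H) (@subIsetr _ K _).
have femb : embedding f.
  (* Both orders unfold through [coset_leP] to conditions on the same representatives; they agree
     because [x^-1 * y] lies in [K] anyway. *)
  have fm : {mono f : A B / A <= B}.
    move=> A B; elim/(quot_ind qK): A => x Kx; elim/(quot_ind qK): B => y Ky.
    rewrite (fE x Kx Kx.2) (fE y Ky Ky.2); apply/idP/idP.
      move=> /(coset_leP qH _ _ _ _ mH) xy; apply/(coset_leP qK _ _ _ _ mK).
      case: xy => [Lxy|]; [left; split=> // | by right].
      by have /subgroupP[_] := hK; apply; [case: Kx | case: Ky].
    move=> /(coset_leP qK _ _ _ _ mK) xy; apply/(coset_leP qH _ _ _ _ mH).
    by case: xy => [[_]|]; [left | right].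
  (* Reflecting the order gives injectivity, by antisymmetry. *)
  by split=> //; apply: inc_inj.
split; [by exists f | split; [|split]].
- rewrite quot_nontrivialP; split=> [[k [[Kk Hk] nKL]]|[k [Kk k1 Hk]]].
    exists k; split=> //.
      by apply/eqP => k1; apply: nKL; split=> //; left.
    apply: contrapT => ne; apply: nKL; split=> //.
    by apply/(lowerE k VH Hk) => e; apply: ne.
  have kH : H k by rewrite Hk; have [] := smod_least 1 k.
  by exists k; split=> // -[_ /(lowerE k VH kH)]; rewrite -Hk.
- move=> x y Kx Ky xy eH.
  have Hxy : H (x^-1 * y) by rewrite eH; have [] := smod_least 1 (x^-1 * y).
  have Kxy : K (x^-1 * y) by have /subgroupP[_] := hK; apply.
  (* As [x^-1 * y] generates [H], it lies outside [lower H], so its coset compares with [1] as it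
     does itself; translation by [x] then gives the rule. *)
  exists (conj Kxy Hxy); rewrite coset_gt1P //; last first.
    by move=> [_ /(lowerE _ VH Hxy)]; rewrite -eH.
  rewrite !lt_def -(mul2_mono x^-1 1 x y) !mulg1 mulVg.
  by rewrite eq_sym xy -(inj_eq (mulgI x)) mulVKg mulg1 eq_sym xy.
- move=> NF ntK; have [tC|tA] := VG_factor_type VH qH NF; [left | right].
    by split=> //; apply: embedding_typeC femb ntK tC.
  by split=> //; apply: embedding_typeA femb ntK tA.
Qed.
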